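(* Let $\mathcal F$ be a group pair with $A$ as in the context. For each pair $(x,y)\in\mathcal E$ the following are equivalent: (i) there are $\alpha<\kappa_{xy}$ and $\beta<\kappa_{yx}$ such that $R_{xy,\alpha}^{-1}=R_{yx,\beta}$; (ii) for every $\alpha<\kappa_{xy}$ there is $\beta<\kappa_{yx}$ such that $R_{xy,\alpha}^{-1}=R_{yx,\beta}$; (iii) $\varphi_{xy}^{-1}=\varphi_{yx}$. Moreover, suppose one of these conditions holds and the cosets of $H_{yx}$ are enumerated according to the convention in the context. Then $\kappa_{yx}=\kappa_{xy}$, and for each $\alpha$ the index $\beta$ in (i) and (ii) is uniquely determined by $H_{xy,\alpha}^{-1}=H_{xy,\beta}$. Finally, $A$ is closed under relational converse if and only if (iii) holds for all $(x,y)\in\mathcal E$.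
   Context: A group pair consists of the following data. - Pairwise disjoint groups $G_x$ ($x\in I$), with operation $\circ$ and identity $e_x$. - An equivalence relation $\mathcal E$ on $I$. - For each $(x,y)\in\mathcal E$, an isomorphism $\varphi_{xy}:G_x/H_{xy}\to G_y/K_{xy}$, where $H_{xy}\trianglelefteq G_x$ and $K_{xy}\trianglelefteq G_y$. Write $X\circ Y=\{a\circ b:a\in X, b\in Y\}$ and $X^{-1}=\{a^{-1}:a\in X\}$. For each $(x,y)\in\mathcal E$ fix an enumeration without repetitions $\langle H_{xy,\gamma}:\gamma<\kappa_{xy}\rangle$ of the cosets of $H_{xy}$ in $G_x$, with $H_{xy,0}=H_{xy}$, and put $K_{xy,\gamma}=\varphi_{xy}(H_{xy,\gamma})$. Define $R_{xy,\alpha}=\bigcup_{\gamma<\kappa_{xy}}H_{xy,\gamma}\times(K_{xy,\gamma}\circ K_{xy,\alpha})$. Let $A$ be the set of all unions of subfamilies of the relations $R_{xy,\alpha}$. The converse of a relation is $R^{-1}=\{(b,a):(a,b)\in R\}$. Convention: when $\varphi_{yx}=\varphi_{xy}^{-1}$ (so that $H_{yx}=K_{xy}$ and $K_{yx}=H_{xy}$), the enumeration of the cosets of $H_{yx}$ is chosen with $\kappa_{yx}=\kappa_{xy}$ and $H_{yx,\gamma}=K_{xy,\gamma}$. Hence $K_{yx,\gamma}=H_{xy,\gamma}$. *)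

(* Defs.v *)
From HB Require Import structures.
From mathcomp Require Import all_boot all_order.
From mathcomp Require Import boolp wochoice classical_sets functions.
From Stdlib Require Import RelationClasses.

Set Implicit Arguments.
Unset Strict Implicit.
Unset Printing Implicit Defensive.

Local Open Scope classical_set_scope.
Local Open Scope relation_scope.

Definition mulset (G : groupType) (X Y : set G) : set G :=
  [set (a * b)%g | a in X & b in Y].

Definition invset (G : groupType) (X : set G) : set G :=
  [set (a^-1)%g | a in X].

Definition normal_subgroup (G : groupType) (H : set G) : Prop :=
  [/\ H 1%g,
      forall a b, H a -> H b -> H (a / b)%g
    & forall a b, H a -> H (a ^ b)%g].

(* The quotient group G/H is the set of cosets of H, multiplied by [mulset]. *)
Definition cosets (G : groupType) (H : set G) : set (set G) :=
  [set mulset [set a] H | a in [set: G]].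

Definition quotient_iso (G G' : groupType) (H : set G) (K : set G')
    (f : set G -> set G') : Prop :=
  set_bij (cosets H) (cosets K) f /\
  forall X Y, cosets H X -> cosets H Y ->
    f (mulset X Y) = mulset (f X) (f Y).

Unset Implicit Arguments.

(* [gp_H x y], [gp_K x y] and [gp_phi x y] are meaningful only when
   [gp_E x y] holds, and then [gp_phi x y] only on the cosets of [gp_H x y]. *)
Record group_pair (I : Type) := GroupPair {
  gp_G : I -> groupType;
  gp_E : I -> I -> Prop;
  gp_H : forall x y : I, set (gp_G x);
  gp_K : forall x y : I, set (gp_G y);
  gp_phi : forall x y : I, set (gp_G x) -> set (gp_G y);
  gp_E_equiv : Equivalence gp_E;
  gp_H_normal : forall x y, gp_E x y -> normal_subgroup (gp_H x y);
  gp_K_normal : forall x y, gp_E x y -> normal_subgroup (gp_K x y);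
  gp_phi_iso : forall x y, gp_E x y ->
    quotient_iso (gp_H x y) (gp_K x y) (gp_phi x y)
}.

Arguments gp_G {I}.
Arguments gp_E {I}.
Arguments gp_H {I}.
Arguments gp_K {I}.
Arguments gp_phi {I}.

(* The disjoint union of the groups: tagging with the index makes the groups
   pairwise disjoint. *)
Definition base {I : Type} (F : group_pair I) : Type := {x : I & gp_G F x}.

Definition inj_base {I : Type} (F : group_pair I) (x : I) (a : gp_G F x) :
  base F := existT (gp_G F) x a.

(* phi_xy as a set of pairs; being restricted to the cosets of H_xy, it
   determines the domain G_x/H_xy, and its range is G_y/K_xy. *)
Definition phi_graph {I : Type} (F : group_pair I) (x y : I) :
    set (set (gp_G F x) * set (gp_G F y)) :=
  [set p | cosets (gp_H F x y) p.1 /\ p.2 = gp_phi F x y p.1].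

(* Ordinals are elements of a well-ordered type O: the ordinal represented by
   k is the order type of the elements below k, and 0 is the bottom. *)
Record coset_enum {I : Type} (F : group_pair I) {d : Order.disp_t}
    (O : bOrderType d) := CosetEnum {
  ce_kappa : I -> I -> O;
  ce_H : forall x y : I, O -> set (gp_G F x);
  ce_H_bij : forall x y, gp_E F x y ->
    set_bij [set g | (g < ce_kappa x y)%O] (cosets (gp_H F x y)) (ce_H x y);
  ce_H0 : forall x y, gp_E F x y -> ce_H x y \bot%O = gp_H F x y
}.

Arguments ce_kappa {I F d O}.
Arguments ce_H {I F d O}.

Section Relations.
Context {I : Type} {F : group_pair I} {d : Order.disp_t} {O : bOrderType d}.
Variable C : coset_enum F O.

Definition ce_K (x y : I) (g : O) : set (gp_G F y) :=
  gp_phi F x y (ce_H C x y g).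

Definition Rel (x y : I) (a : O) : set (base F * base F) :=
  \bigcup_(g in [set g | (g < ce_kappa C x y)%O])
    ((inj_base F x @` ce_H C x y g) `*`
     (inj_base F y @` mulset (ce_K x y g) (ce_K x y a))).

Definition atoms : set (set (base F * base F)) :=
  [set R | exists x y a,
    [/\ gp_E F x y, (a < ce_kappa C x y)%O & R = Rel x y a]].

Definition algA : set (set (base F * base F)) :=
  [set S | exists2 X, X `<=` atoms & S = \bigcup_(R in X) R].

Definition enum_convention (x y : I) : Prop :=
  ce_kappa C y x = ce_kappa C x y /\
  forall g, (g < ce_kappa C x y)%O -> ce_H C y x g = ce_K x y g.

Definition cond_i (x y : I) : Prop :=
  exists a b, [/\ (a < ce_kappa C x y)%O, (b < ce_kappa C y x)%O
                & (Rel x y a)^-1 = Rel y x b].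

Definition cond_ii (x y : I) : Prop :=
  forall a, (a < ce_kappa C x y)%O ->
    exists2 b, (b < ce_kappa C y x)%O & (Rel x y a)^-1 = Rel y x b.

End Relations.

Definition cond_iii {I : Type} (F : group_pair I) (x y : I) : Prop :=
  (phi_graph F x y)^-1 = phi_graph F y x.

(* Main.v *)
(* Write [a] for the coset of a in the quotient at hand.  If H_{xy,al} = [c],
   then (a, b) lies in R_{xy,al} iff phi_xy [a c] = [b].  Suppose the converse
   of R_{xy,al} is a union of relations R_{yx,be}.  Fixing one coordinate and
   moving the other inside a coset gives K_yx <= H_xy and H_yx <= K_xy; the same
   for (y, x) gives the reverse inclusions, so the quotients agree, and the
   equation phi_xy [a c] = [b] can then be normalised by c to show that phi_yx
   inverts phi_xy.  Both (i) (a one-element union, used for (x, y) and (y, x))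
   and closure of A under converse (applied to the index 0) provide such unions.
   Conversely, if phi_yx inverts phi_xy, the converse of R_{xy,al} is
   R_{yx,be} exactly when H_{yx,be} is the inverse of K_{xy,al}. *)
Require Import Defs.
From HB Require Import structures.
From mathcomp Require Import all_boot all_order.
From mathcomp Require Import boolp wochoice classical_sets functions.

Local Open Scope classical_set_scope.
Local Open Scope relation_scope.

Set Implicit Arguments.
Unset Strict Implicit.
Unset Printing Implicit Defensive.

(** * Coset arithmetic modulo a normal subgroup, on representatives *)

Section Quotients.
Context {G : groupType}.
Implicit Types (H X Y : set G) (a b : G).

Definition coset H a : set G := mulset [set a] H.

Lemma cosetE H a b : coset H a b <-> H (a^-1 * b)%g.
Proof.
split=> [[_ -> [h Hh <-]]|Hab]; first by rewrite mulgA mulVg mul1g.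
by exists a => //; exists (a^-1 * b)%g => //; rewrite mulgA mulgV mul1g.
Qed.

Lemma cosets_coset H a : cosets H (coset H a).
Proof. by exists a. Qed.

Lemma normal_inv H a : normal_subgroup H -> H a -> H a^-1%g.
Proof. by case=> H1 HV _ Ha; rewrite -[(a^-1)%g]mul1g; apply: HV. Qed.

Lemma normal_mul H a b : normal_subgroup H -> H a -> H b -> H (a * b)%g.
Proof.
move=> nH Ha Hb; case: (nH) => _ HV _.
by rewrite -[b]invgK; apply: HV => //; apply: normal_inv.
Qed.

Lemma coset_refl H a : normal_subgroup H -> coset H a a.
Proof. by case=> H1 _ _; apply/cosetE; rewrite mulVg. Qed.

Lemma eq_cosetP H a b : normal_subgroup H ->
  coset H a = coset H b <-> H (a^-1 * b)%g.
Proof.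
move=> nH; split=> [eqab|Hab].
  by apply/cosetE; rewrite eqab; apply: coset_refl.
rewrite predeqE => z; split=> /cosetE Hz; apply/cosetE.
  have -> : (b^-1 * z = (a^-1 * b)^-1 * (a^-1 * z))%g.
    by rewrite invgM invgK -mulgA (mulgA a) mulgV mul1g.
  by apply: normal_mul => //; apply: normal_inv.
have -> : (a^-1 * z = (a^-1 * b) * (b^-1 * z))%g.
  by rewrite -mulgA (mulgA b) mulgV mul1g.
exact: normal_mul.
Qed.

Lemma coset_eqE H a b : normal_subgroup H -> coset H a b <-> coset H a = coset H b.
Proof. by move=> nH; rewrite (eq_cosetP _ _ nH); apply: cosetE. Qed.

Lemma coset1 H : coset H 1%g = H.
Proof.
by rewrite predeqE => z; split=> [/cosetE|Hz]; [|apply/cosetE];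
  rewrite invg1 mul1g.
Qed.

Lemma cosets_eq H Y : normal_subgroup H -> cosets H Y -> Y 1%g -> Y = H.
Proof.
move=> nH [a _ <-] /(coset_eqE _ _ nH); rewrite -/(coset H a) => ->.
exact: coset1.
Qed.

Lemma mulset_coset H a b : normal_subgroup H ->
  mulset (coset H a) (coset H b) = coset H (a * b)%g.
Proof.
move=> nH; case: (nH) => _ _ HJ; rewrite predeqE => z; split.
  case=> u /cosetE Hu [v /cosetE Hv <-]; apply/cosetE.
  have -> : ((a * b)^-1 * (u * v) = (a^-1 * u) ^ b * (b^-1 * v))%g.
    by rewrite invgM conjgE !mulgA -(mulgA _ b) mulgV mulg1.
  by apply: normal_mul => //; apply: HJ.
move=> /cosetE Hz; exists a; first exact: coset_refl.
exists (a^-1 * z)%g; last by rewrite mulgA mulgV mul1g.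
by apply/cosetE; rewrite mulgA -invgM.
Qed.

Lemma invset_coset H a : normal_subgroup H ->
  invset (coset H a) = coset H a^-1%g.
Proof.
move=> nH; case: (nH) => _ _ HJ; rewrite predeqE => z.
(* Inversion exchanges left and right congruence modulo [H]; conjugating by [u^-1] shows that these
   agree. *)
have swap u v : H (u^-1 * v)%g -> H (u * v^-1)%g.
  move=> /(normal_inv nH) /(HJ _ u^-1%g).
  by rewrite conjgE invgM !invgK !mulgA mulgK.
split=> [[u /cosetE Hu <-]|/cosetE]; first by apply/cosetE; rewrite invgK; apply: swap.
move=> Hz; exists z^-1%g; last by rewrite invgK.
by apply/cosetE; apply: swap Hz.
Qed.

Lemma coset_mulKr H a b c : normal_subgroup H ->
  coset H (a * c)%g = coset H (b * c)%g -> coset H a = coset H b.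
Proof.
move=> nH eqac.
by rewrite -[a](mulgK c) -[b](mulgK c) -(mulset_coset (a * c) _ nH) eqac mulset_coset.
Qed.

(** Cancelling [a] in the quotient turns the equation into [h] = [1]. This tests membership in [H]
    at any convenient base point [a]. *)
Lemma coset_id_normal H h a : normal_subgroup H ->
  coset H (h * a)%g = coset H a <-> H h.
Proof.
move=> nH; split=> [eqa|Hh].
  suff /esym/(coset_eqE _ _ nH) : coset H h = coset H 1%g by rewrite coset1.
  by apply: (@coset_mulKr _ _ _ a) => //; rewrite mul1g.
rewrite -mulset_coset //.
have -> : coset H h = coset H 1%g.
  by apply/esym/(coset_eqE _ _ nH); rewrite coset1.
by rewrite mulset_coset // mul1g.
Qed.

End Quotients.

(** * Quotient isomorphisms, on representatives *)

Section Isomorphisms.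
Context {G G' : groupType} {H : set G} {K : set G'}.
Context {f : set G -> set G'}.
Hypotheses (nH : normal_subgroup H) (nK : normal_subgroup K).
Hypothesis iso_f : quotient_iso H K f.

Lemma iso_coset a : exists b, f (coset H a) = coset K b.
Proof.
case: iso_f => -[fK _ _] _.
by have [b _ <-] := fK _ (cosets_coset H a); exists b.
Qed.

Lemma iso_inj a a' : f (coset H a) = f (coset H a') -> coset H a = coset H a'.
Proof.
by case: iso_f => -[_ fI _] _; apply: fI; rewrite inE; apply: cosets_coset.
Qed.

Lemma isoM a a' b b' : f (coset H a) = coset K b -> f (coset H a') = coset K b' ->
  f (coset H (a * a')%g) = coset K (b * b')%g.
Proof.
case: iso_f => _ fM fa fa'.
by rewrite -!mulset_coset // fM ?fa ?fa' //; apply: cosets_coset.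
Qed.

(** The image of [1] is idempotent, hence trivial by cancellation. *)
Lemma iso1 : f (coset H 1%g) = coset K 1%g.
Proof.
have [b fb] := iso_coset 1%g.
have := isoM fb fb; rewrite mulg1 fb => /esym bb.
by apply: (@coset_mulKr _ _ _ _ b) => //; rewrite mul1g.
Qed.

Lemma isoV a b : f (coset H a) = coset K b ->
  f (coset H a^-1%g) = coset K b^-1%g.
Proof.
move=> fa; have [c fc] := iso_coset a^-1%g; rewrite fc.
apply: (@coset_mulKr _ _ _ _ b) => //.
by rewrite -(isoM fc fa) !mulVg iso1.
Qed.

End Isomorphisms.

(** * What a converse of union form forces on two quotient isomorphisms *)

Section Converse.
Context {G G' : groupType} {H K' : set G} {K H' : set G'}.
Context {f : set G -> set G'} {g : set G' -> set G}.
Hypotheses (nH : normal_subgroup H) (nK : normal_subgroup K).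
Hypotheses (nH' : normal_subgroup H') (nK' : normal_subgroup K').
Hypotheses (iso_f : quotient_iso H K f) (iso_g : quotient_iso H' K' g).

(* In terms of representatives: the converse of the relation R_{xy,al} with
   H_{xy,al} = [c] is the union of the R_{yx,be} with H_{yx,be} = [d], d in D. *)
Definition converse_union (c : G) (D : set G') : Prop :=
  forall a b, f (coset H (a * c)%g) = coset K b <->
    exists2 d, D d & g (coset H' (b * d)%g) = coset K' a.

(** With f [c] = [b], the pair (1, b) is related. The [g] side sees [a] only modulo [K'], so (k, b)
    is related too, whence f [k c] = f [c], and injectivity applies. *)
Lemma converse_union_ker c D : converse_union c D -> K' `<=` H.
Proof.
move=> cD k Kk; have [b fb] := iso_coset iso_f c.
have [] := (cD 1%g b).1; first by rewrite mul1g.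
move=> d Dd gd; apply/(coset_id_normal k c nH)/(iso_inj iso_f).
rewrite fb; apply/cD; exists d => //; rewrite gd.
by apply/(coset_eqE _ _ nK'); rewrite coset1.
Qed.

(** Dually, the [g] side sees [b] only modulo [H'], so (1, b) and (1, h b) are both related and
    [h b] = [b] modulo [K]. *)
Lemma converse_union_dom c D : converse_union c D -> H' `<=` K.
Proof.
move=> cD h Hh; have [b fb] := iso_coset iso_f c.
have [] := (cD 1%g b).1; first by rewrite mul1g.
move=> d Dd gd; apply/(coset_id_normal h b nK).
rewrite -fb -[c in RHS]mul1g; apply/esym/cD; exists d => //.
by rewrite -mulgA (coset_id_normal _ _ nH').2.
Qed.

Lemma converse_union_iso c D : K' = H -> H' = K -> converse_union c D ->
  forall a b, f (coset H a) = coset K b <-> g (coset H' b) = coset K' a.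
Proof.
move=> eqH eqK cD.
have [b0 fb0] := iso_coset iso_f c.
have [] := (cD 1%g b0).1; first by rewrite mul1g.
move=> d Dd _.
(* The pair (1, d^-1) is related, since g [d^-1 d] = [1]. *)
have fc : f (coset H c) = coset K d^-1%g.
  rewrite -[c]mul1g; apply/cD; exists d => //.
  by rewrite mulVg; apply: iso1 iso_g.
(* The pair (a, b d^-1) is related; multiplying by f [c^-1] = [d] removes the shift. *)
have gf a b : g (coset H' b) = coset K' a -> f (coset H a) = coset K b.
  move=> gb; have fac : f (coset H (a * c)%g) = coset K (b / d)%g.
    by apply/cD; exists d => //; rewrite mulgVK.
  by have := isoM nH nK iso_f fac (isoV nH nK iso_f fc); rewrite invgK mulgK mulgVK.
move=> a b; split=> [fa|]; last exact: gf.
have [a' gb] := iso_coset iso_g b.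
rewrite gb eqH; apply: (iso_inj iso_f).
by rewrite (gf _ _ gb).
Qed.

End Converse.

(** * The relations of a group pair and their converses *)

Section GroupPairs.
Import Order.TTheory.
Context {I : Type} {F : group_pair I} {d : Order.disp_t} {O : bOrderType d}.
Variable C : coset_enum F O.
Implicit Types (x y : I).

Let nH x y (E : gp_E F x y) := gp_H_normal _ F x y E.
Let nK x y (E : gp_E F x y) := gp_K_normal _ F x y E.
Let iso x y (E : gp_E F x y) := gp_phi_iso _ F x y E.

Lemma gp_E_sym x y : gp_E F x y -> gp_E F y x.
Proof. by case: (gp_E_equiv _ F) => _ sE _; apply: sE. Qed.

Lemma inj_base_inj x : injective (@inj_base I F x).
Proof.
move=> a a' eqa; have /= := projT2_eq eqa.
(* The transport runs along a proof of [x = x], which proof irrelevance makes trivial. *)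
by rewrite (Prop_irrelevance (projT1_eq eqa) erefl).
Qed.

Lemma ce_H_coset x y g : gp_E F x y -> (g < ce_kappa C x y)%O ->
  exists c, ce_H C x y g = coset (gp_H F x y) c.
Proof. by move=> E ltg; case: (ce_H_bij _ _ C _ _ E) => /(_ _ ltg) [c _ <-]; exists c. Qed.

Lemma coset_ce_H x y c : gp_E F x y ->
  exists2 g, (g < ce_kappa C x y)%O & ce_H C x y g = coset (gp_H F x y) c.
Proof. by move=> E; case: (ce_H_bij _ _ C _ _ E) => _ _ /(_ _ (cosets_coset _ c)). Qed.

Lemma ce_H_inj x y g g' : gp_E F x y ->
  (g < ce_kappa C x y)%O -> (g' < ce_kappa C x y)%O ->
  ce_H C x y g = ce_H C x y g' -> g = g'.
Proof. by move=> E lg lg'; case: (ce_H_bij _ _ C _ _ E) => _ + _; apply; rewrite inE. Qed.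

Lemma ce_kappa_gt0 x y : gp_E F x y -> (\bot < ce_kappa C x y)%O.
Proof.
by move=> E; have [g ltg _] := coset_ce_H 1%g E; apply: le_lt_trans ltg; apply: le0x.
Qed.

(** If the coset with index g is [a], its block has second factor phi [a] phi [c] = phi [a c], so
    the union over g becomes one equation. *)
Lemma Rel_coset x y al c p : gp_E F x y ->
  ce_H C x y al = coset (gp_H F x y) c ->
  Rel C x y al p <-> exists a b, p = (inj_base F x a, inj_base F y b) /\
    gp_phi F x y (coset (gp_H F x y) (a * c)%g) = coset (gp_K F x y) b.
Proof.
move=> E alc; have mulphi a : mulset (gp_phi F x y (coset (gp_H F x y) a))
    (ce_K C x y al) = gp_phi F x y (coset (gp_H F x y) (a * c)%g).
  rewrite /ce_K alc; case: (iso E) => _ phiM.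
  by rewrite -phiM ?mulset_coset //; try exact: cosets_coset; apply: nH.
split=> [[g /= ltg]|].
  have [e ge] := ce_H_coset E ltg.
  case: p => _ _ [/= [a ga <-] [b + <-]] => gb; exists a, b; split=> //.
  move: gb ga; rewrite /ce_K ge mulphi => gb /(coset_eqE _ _ (nH E)) ea.
  have [b' fb'] := iso_coset (iso E) (e * c)%g.
  have -> : coset (gp_H F x y) (a * c)%g = coset (gp_H F x y) (e * c)%g.
    by rewrite -!mulset_coset ?ea //; apply: nH.
  by move: gb; rewrite fb' => /(coset_eqE _ _ (nK E)).
case=> a [b [-> fac]]; have [g ltg ga] := coset_ce_H a E.
exists g => //; split; [exists a|exists b] => //=.
  by rewrite ga; apply: coset_refl (nH E).
rewrite /ce_K ga mulphi fac; exact: coset_refl (nK E).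
Qed.

Lemma Rel_inj_base x y al c a b : gp_E F x y ->
  ce_H C x y al = coset (gp_H F x y) c ->
  Rel C x y al (inj_base F x a, inj_base F y b) <->
  gp_phi F x y (coset (gp_H F x y) (a * c)%g) = coset (gp_K F x y) b.
Proof.
move=> E alc; split=> [/(Rel_coset _ E alc)|fac].
  by case=> a' [b' [[/inj_base_inj-> /inj_base_inj->]]].
by apply/(Rel_coset _ E alc); exists a, b.
Qed.

(** Thus relations over different index pairs are disjoint, which localises unions in [algA] to one
    pair. *)
Lemma Rel_indices x y al p : Rel C x y al p -> projT1 p.1 = x /\ projT1 p.2 = y.
Proof. by case: p => u v [g _ [/= [a _ <-] [b _ <-]]]. Qed.

(** Equality of graphs includes equality of domains. The graph pairs [H_xy] with [K_xy], so [K_xy]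
    is a coset of [H_yx]; containing 1, it equals [H_yx]. The other equality is symmetric. *)
Lemma cond_iiiP x y : gp_E F x y -> cond_iii F x y <->
  [/\ gp_K F y x = gp_H F x y, gp_H F y x = gp_K F x y &
    forall a b, gp_phi F x y (coset (gp_H F x y) a) = coset (gp_K F x y) b <->
                gp_phi F y x (coset (gp_H F y x) b) = coset (gp_K F y x) a].
Proof.
move=> E; have E' := gp_E_sym E.
split=> [iii|[eqH eqK phiP]].
  have P X Y : cosets (gp_H F x y) X /\ Y = gp_phi F x y X <->
      cosets (gp_H F y x) Y /\ X = gp_phi F y x Y.
    by move/predeqP : iii => /(_ (Y, X)).
  have f1 := iso1 (nH E) (nK E) (iso E); have g1 := iso1 (nH E') (nK E') (iso E').
  have eqK : gp_H F y x = gp_K F x y.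
    have [+ _] := (P _ _).1 (conj (cosets_coset _ 1%g) (esym f1)).
    rewrite coset1 => cK; apply/esym/(cosets_eq (nH E') cK).
    by case: (nK E).
  have eqH : gp_K F y x = gp_H F x y.
    have [+ _] := (P _ _).2 (conj (cosets_coset _ 1%g) (esym g1)).
    rewrite coset1 => cK; apply: (cosets_eq (nH E) cK).
    by case: (nK E').
  split=> // a b; split=> [fa|gb].
    by have [_] := (P _ _).1 (conj (cosets_coset _ a) (esym fa)); rewrite eqH eqK.
  by have [_] := (P _ _).2 (conj (cosets_coset _ b) (esym gb)); rewrite eqH eqK.
rewrite /cond_iii predeqE => -[Y X]; rewrite /phi_graph /=; split=> -[].
  move=> [a _ <-] ->; have [b fb] := iso_coset (iso E) a.
  rewrite -/(coset _ a) fb -eqK; split; first exact: cosets_coset.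
  by rewrite (phiP a b).1 // eqH.
move=> [b _ <-] ->; have [a gb] := iso_coset (iso E') b.
rewrite -/(coset _ b) gb eqH; split; first exact: cosets_coset.
by rewrite (phiP a b).2 // eqK.
Qed.

Lemma Rel_converseP x y al be : gp_E F x y -> cond_iii F x y ->
  (al < ce_kappa C x y)%O -> (be < ce_kappa C y x)%O ->
  (Rel C x y al)^-1 = Rel C y x be <->
  ce_H C y x be = invset (ce_K C x y al).
Proof.
move=> E iii ltal ltbe; have E' := gp_E_sym E.
have [eqH eqK phiP] := (cond_iiiP E).1 iii.
have [c alc] := ce_H_coset E ltal; have [e bee] := ce_H_coset E' ltbe.
have [u fc] := iso_coset (iso E) c.
rewrite /ce_K alc fc invset_coset; last exact: nK.
rewrite bee eqK.
have RelE a b : Rel C y x be (inj_base F y b, inj_base F x a) <->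
    gp_phi F x y (coset (gp_H F x y) a) = coset (gp_K F x y) (b * e)%g.
  by rewrite (Rel_inj_base _ _ E' bee); split=> /phiP.
split=> [relC|eqe].
  (* Testing the equality at this one point gives phi [c] = [e^-1]. *)
  have : Rel C y x be (inj_base F y e^-1%g, inj_base F x 1%g).
    by apply/RelE; rewrite mulVg; apply: iso1 (nH E) (nK E) (iso E).
  rewrite -relC => /(Rel_inj_base _ _ E alc); rewrite mul1g.
  move=> /(isoV (nH E) (nK E) (iso E)); rewrite invgK => <-.
  by have := isoV (nH E) (nK E) (iso E) fc.
have fcV := isoV (nH E) (nK E) (iso E) fc; rewrite -eqe in fcV.
have {}fc := isoV (nH E) (nK E) (iso E) fcV; rewrite invgK in fc.
(* Multiplying by phi [c^-1] = [e] or phi [c] = [e^-1] passes between phi [a c] = [b] and phi [a] =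
   [b e]. *)
have relE a b : Rel C x y al (inj_base F x a, inj_base F y b) <->
    Rel C y x be (inj_base F y b, inj_base F x a).
  rewrite (Rel_inj_base _ _ E alc) RelE; split=> fa.
    by have := isoM (nH E) (nK E) (iso E) fa fcV; rewrite mulgK.
  by have := isoM (nH E) (nK E) (iso E) fa fc; rewrite mulgK.
rewrite predeqE => -[v w]; split=> [relwv|relvw].
  have [a [b [[eqw eqv] _]]] := (Rel_coset (w, v) E alc).1 relwv.
  by move: relwv; rewrite /= eqw eqv => /relE.
have [b [a [[eqv eqw] _]]] := (Rel_coset (v, w) E' bee).1 relvw.
by move: relvw; rewrite /= eqw eqv => /relE.
Qed.

(** An isomorphism commutes with inversion and is injective, so the condition can be moved from
    [G_y] to [G_x]. *)
Lemma ce_K_invset x y al be : gp_E F x y ->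
  (al < ce_kappa C x y)%O -> (be < ce_kappa C x y)%O ->
  ce_K C x y be = invset (ce_K C x y al) <->
  invset (ce_H C x y al) = ce_H C x y be.
Proof.
move=> E ltal ltbe; rewrite /ce_K.
have [c ->] := ce_H_coset E ltal; have [e ->] := ce_H_coset E ltbe.
have [u fc] := iso_coset (iso E) c.
have fcV := isoV (nH E) (nK E) (iso E) fc.
rewrite fc !invset_coset; [|exact: nH|exact: nK].
by rewrite -fcV; split=> [/(iso_inj (iso E))|<-].
Qed.

(** Passes from indices to representatives: the new set consists of all representatives of the
    cosets with index in [D]. *)
Lemma converse_union_Rel x y al (D : set O) : gp_E F x y ->
  (al < ce_kappa C x y)%O -> (forall be, D be -> (be < ce_kappa C y x)%O) ->
  (Rel C x y al)^-1 = \bigcup_(be in D) Rel C y x be ->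
  exists c D', @converse_union _ _ (gp_H F x y) (gp_K F y x) (gp_K F x y)
    (gp_H F y x) (gp_phi F x y) (gp_phi F y x) c D'.
Proof.
move=> E ltal ltD relC; have E' := gp_E_sym E.
have [c alc] := ce_H_coset E ltal.
exists c, [set e | exists2 be, D be & ce_H C y x be = coset (gp_H F y x) e].
move=> a b; rewrite -(Rel_inj_base _ _ E alc).
move/predeqP: relC => /(_ (inj_base F y b, inj_base F x a)) /= relC.
apply: iff_trans relC _; split=> [[be Dbe relba]|[e [be Dbe bee] gbe]].
  have [e bee] := ce_H_coset E' (ltD _ Dbe).
  by exists e; [exists be | apply/(Rel_inj_base _ _ E' bee)].
by exists be => //; apply/(Rel_inj_base _ _ E' bee).
Qed.

(** Common source of (iii) from (i) and from closure under converse; [al] and [be] are chosen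
    independently. *)
Lemma cond_iii_of_converse_unions x y al be (D D' : set O) : gp_E F x y ->
  (al < ce_kappa C x y)%O -> (be < ce_kappa C y x)%O ->
  (forall g, D g -> (g < ce_kappa C y x)%O) ->
  (forall g, D' g -> (g < ce_kappa C x y)%O) ->
  (Rel C x y al)^-1 = \bigcup_(g in D) Rel C y x g ->
  (Rel C y x be)^-1 = \bigcup_(g in D') Rel C x y g ->
  cond_iii F x y.
Proof.
move=> E ltal ltbe ltD ltD' relal relbe; have E' := gp_E_sym E.
have [c [S cS]] := converse_union_Rel E ltal ltD relal.
have [e [T eT]] := converse_union_Rel E' ltbe ltD' relbe.
have eqH : gp_K F y x = gp_H F x y.
  rewrite eqEsubset; split.
    exact: (converse_union_ker (nH E) (nK E') (iso E) cS).
  exact: (converse_union_dom (nK E') (nH E) (iso E') eT).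
have eqK : gp_H F y x = gp_K F x y.
  rewrite eqEsubset; split.
    exact: (converse_union_dom (nK E) (nH E') (iso E) cS).
  exact: (converse_union_ker (nH E') (nK E) (iso E') eT).
apply/(cond_iiiP E); split=> //.
exact: (converse_union_iso (nH E) (nK E) (nH E') (nK E') (iso E) (iso E') eqH eqK cS).
Qed.

(** * Equivalence of the three conditions *)

Lemma cond_i_iii x y : gp_E F x y -> cond_i C x y -> cond_iii F x y.
Proof.
move=> E [al [be [ltal ltbe relC]]].
apply: (@cond_iii_of_converse_unions x y al be [set be] [set al]) => //.
- by move=> _ ->.
- by move=> _ ->.
- by rewrite bigcup_set1.
- by rewrite bigcup_set1 -relC; apply/predeqP => -[].
Qed.

Lemma cond_iii_ii x y : gp_E F x y -> cond_iii F x y -> cond_ii C x y.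
Proof.
move=> E iii al ltal; have E' := gp_E_sym E.
have [_ eqK _] := (cond_iiiP E).1 iii.
have [c alc] := ce_H_coset E ltal; have [u fc] := iso_coset (iso E) c.
(* As [H_yx = K_xy], this is the index of the inverse of [K_{xy,al}] = [u]. *)
have [be ltbe bee] := coset_ce_H u^-1%g E'.
exists be => //; apply/(Rel_converseP E) => //.
by rewrite bee /ce_K alc fc invset_coset ?eqK //; apply: nK.
Qed.

Lemma cond_ii_i x y : gp_E F x y -> cond_ii C x y -> cond_i C x y.
Proof.
move=> E ii; have lt0 := ce_kappa_gt0 E.
by have [be ltbe relC] := ii _ lt0; exists \bot%O, be.
Qed.

(** * Closure of [algA] under converse *)

Lemma algA_Rel x y al : gp_E F x y -> (al < ce_kappa C x y)%O ->
  algA C (Rel C x y al).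
Proof.
move=> E ltal; exists [set Rel C x y al]; last by rewrite bigcup_set1.
by move=> _ ->; exists x, y, al.
Qed.

Lemma algA_converse_Rel x y al : gp_E F x y -> (al < ce_kappa C x y)%O ->
  algA C (Rel C x y al)^-1 ->
  exists2 D : set O, forall g, D g -> (g < ce_kappa C y x)%O &
    (Rel C x y al)^-1 = \bigcup_(g in D) Rel C y x g.
Proof.
move=> E ltal [X Xat relC].
have relX R p : X R -> R p -> (Rel C x y al)^-1 p.
  by move=> XR Rp; rewrite relC; exists R.
exists [set g | (g < ce_kappa C y x)%O /\ X (Rel C y x g)]; first by move=> g [].
rewrite predeqE => p; split=> [|[g [_ Xg] relp]]; last exact: relX Xg relp.
rewrite relC => -[R XR Rp].
have [x' [y' [g [E' ltg eqR]]]] := Xat _ XR.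
(* The point lies both in [R] and in the converse, so its tags force [x' = y] and [y' = x]. *)
have := relX _ _ XR Rp; case: p Rp => v w Rp /= /Rel_indices /= [ex ey].
move: Rp XR; rewrite eqR => Rp; have /= [ex' ey'] := Rel_indices Rp.
move: Rp ltg; rewrite -ex' -ey' ex ey => Rp ltg Xg.
by exists g.
Qed.

End GroupPairs.

Theorem theorem3p8 (I : Type) (F : group_pair I)
    (d : Order.disp_t) (O : bOrderType d)
    (O_wo : well_order (@Order.le d O)) (C : coset_enum F O) :
  (forall x y : I, gp_E F x y ->
     [/\ cond_i C x y <-> cond_ii C x y,
         cond_ii C x y <-> cond_iii F x y
       & [\/ cond_i C x y, cond_ii C x y | cond_iii F x y] ->
         enum_convention C x y ->
         ce_kappa C y x = ce_kappa C x y /\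
         forall a : O, (a < ce_kappa C x y)%O ->
           (exists! b : O, (b < ce_kappa C y x)%O /\
                           (Rel C x y a)^-1 = Rel C y x b) /\
           (forall b : O, (b < ce_kappa C y x)%O ->
              ((Rel C x y a)^-1 = Rel C y x b <->
               invset (ce_H C x y a) = ce_H C x y b))]) /\
  ((forall S, algA C S -> algA C S^-1) <->
   (forall x y : I, gp_E F x y -> cond_iii F x y)).
Proof.
split=> [x y E|].
  have i_iii := @cond_i_iii _ _ _ _ C x y E.
  have iii_ii := @cond_iii_ii _ _ _ _ C x y E.
  have ii_i := @cond_ii_i _ _ _ _ C x y E.
  split; [by split=> [/i_iii/iii_ii|/ii_i]|by split=> [/ii_i/i_iii|/iii_ii]|].
  move=> cond [eqkappa eqH].
  have iii : cond_iii F x y by case: cond => [/i_iii|/ii_i/i_iii|].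
  split=> // a lta; split=> [|b ltb].
    have [b ltb relC] := iii_ii iii a lta; exists b; split=> // b' [ltb' relC'].
    (* Both indices enumerate the same coset, the inverse of [K_{xy,a}]. *)
    apply: (ce_H_inj (gp_E_sym E) ltb ltb').
    by rewrite ((Rel_converseP E iii lta ltb).1 relC)
      ((Rel_converseP E iii lta ltb').1 relC').
  rewrite (Rel_converseP E iii lta ltb); move: ltb; rewrite eqkappa => ltb.
  (* The convention replaces [H_{yx,b}] by [K_{xy,b}]. *)
  by rewrite eqH //; apply: ce_K_invset.
split=> [closedA x y E|iii S [X Xat ->]].
  have E' := gp_E_sym E.
  have lt0 := ce_kappa_gt0 C E; have lt0' := ce_kappa_gt0 C E'.
  have [D ltD relD] := algA_converse_Rel E lt0 (closedA _ (algA_Rel E lt0)).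
  have [D' ltD' relD'] := algA_converse_Rel E' lt0' (closedA _ (algA_Rel E' lt0')).
  exact: (cond_iii_of_converse_unions E lt0 lt0' ltD ltD' relD relD').
(* Converse commutes with unions, and by (ii) it sends atoms to atoms. *)
exists [set R^-1 | R in X]; last by rewrite bigcup_image; apply/predeqP => -[].
move=> _ [R /Xat [x [y [a [E lta ->]]]] <-].
have [b ltb ->] := cond_iii_ii E (iii _ _ E) lta.
by exists y, x, b; split=> //; apply: gp_E_sym.
Qed.
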